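(* For every $n\ge 3$: $s_n^0(132,213,321)=n-1$, and $s_n^k(132,213,321)=I_{n=k}$ for all $1\le k\le n$.
   Context: $S_n$ denotes the set of permutations of $\{1,\dots,n\}$ written in one-line notation $\pi=\pi_1\pi_2\cdots\pi_n$. For $\alpha\in S_m$, $\pi\in S_n$ contains the pattern $\alpha$ if there are indices $i_1<i_2<\dots<i_m$ such that $\pi_{i_1}\pi_{i_2}\cdots\pi_{i_m}$ is order-isomorphic to $\alpha$; otherwise $\pi$ avoids $\alpha$. For a set $T$ of patterns, $S_n^k(T)$ is the set of $\pi\in S_n$ that have exactly $k$ fixed points (indices $i$ with $\pi_i=i$) and avoid every pattern in $T$; $s_n^k(T)=|S_n^k(T)|$. The braces around $T$ are omitted, e.g. $s_n^k(132,213,321)=s_n^k(\{132,213,321\})$. For a statement $P$, $I_P=1$ if $P$ is true and $I_P=0$ if $P$ is false. *)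

(* Defs.v *)
From mathcomp Require Import all_boot all_fingroup.
Set Implicit Arguments.
Unset Strict Implicit.
Unset Printing Implicit Defensive.

(* 'S_n permutes 'I_n = {0, ..., n.-1}: positions and values are both shifted
   down by one from {1, ..., n}, which changes neither the fixed points nor
   pattern containment. *)

Definition one_line n (p : 'S_n) : seq nat := [seq (p i).+1 | i : 'I_n].

Definition contains m n (a : 'S_m) (p : 'S_n) : bool :=
  [exists f : {ffun 'I_m -> 'I_n},
    [forall i : 'I_m, forall j : 'I_m, (i < j) ==> (f i < f j)] &&
    [forall i : 'I_m, forall j : 'I_m, (p (f i) < p (f j)) == (a i < a j)]].

Definition avoids m n (a : 'S_m) (p : 'S_n) : bool := ~~ contains a p.

(* Patterns in one set may have different lengths. *)
Definition pattern := {m : nat & 'S_m}.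
Definition mkpattern m (a : 'S_m) : pattern := existT _ m a.

Definition fixpoints n (p : 'S_n) : {set 'I_n} := [set i | p i == i].

Definition avoiders n k (T : seq pattern) : {set 'S_n} :=
  [set p | (#|fixpoints p| == k) & all (fun a => avoids (projT2 a) p) T].

Definition num_avoiders n k (T : seq pattern) : nat := #|avoiders n k T|.

Definition p132 : 'S_3 := tperm (inord 1) (inord 2).
Definition p213 : 'S_3 := tperm (inord 0) (inord 1).
Definition p321 : 'S_3 := tperm (inord 0) (inord 2).

Fact one_line_p132 : one_line p132 = [:: 1; 3; 2].
Proof.
rewrite /one_line /image_mem enum_ordSl enum_ordSl enum_ordSl enum_ord0 /=.
by rewrite !permE /= -!val_eqE /= !inordK.
Qed.

Fact one_line_p213 : one_line p213 = [:: 2; 1; 3].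
Proof.
rewrite /one_line /image_mem enum_ordSl enum_ordSl enum_ordSl enum_ord0 /=.
by rewrite !permE /= -!val_eqE /= !inordK.
Qed.

Fact one_line_p321 : one_line p321 = [:: 3; 2; 1].
Proof.
rewrite /one_line /image_mem enum_ordSl enum_ordSl enum_ordSl enum_ord0 /=.
by rewrite !permE /= -!val_eqE /= !inordK.
Qed.

(* Main.v *)
Require Import Defs.
From mathcomp Require Import all_boot all_fingroup.
From mathcomp Require Import ssralg zmodp zify.

(** The permutations that avoid 132, 213 and 321 are exactly the cyclic shifts
    [i |-> d + i] modulo the length.

    Let [p] avoid the three patterns and look at two adjacent positions [i] and
    [i + 1].  If [p] ascends there, a value strictly between [p i] and
    [p (i + 1)] would complete a 213 when it sits to the left and a 132 when it
    sits to the right, so [p (i + 1) = p i + 1].  If [p] descends there, a value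
    above [p i] would complete a 321 on the left or a 213 on the right, and a
    value below [p (i + 1)] would complete a 132 on the left or a 321 on the
    right, so [p i] is the greatest value and [p (i + 1)] the least.  In both
    cases [p (i + 1)] is the cyclic successor of [p i]
    ([avoiding_cyclic_succ]), hence [p] is the shift by its first value.
    Conversely, a cyclic shift is a concatenation of two increasing runs, all
    values of the first lying above all values of the second, and none of the
    three patterns fits into that shape ([shift_avoids]).

    A shift by [d] has no fixed point unless [d = 0], in which case it is the
    identity.  So among the [n] shifts one has [n] fixed points and the other
    [n - 1] have none. *)

Set Implicit Arguments.
Unset Strict Implicit.
Unset Printing Implicit Defensive.

Lemma ord3_ind (P : 'I_3 -> Prop) :
  P (inord 0) -> P (inord 1) -> P (inord 2) -> forall i, P i.
Proof.
move=> P0 P1 P2 i; rewrite -(inord_val i).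
by case: i => [[|[|[|]]]].
Qed.

(** An occurrence of a pattern of length 3 is a triple of positions; since the
    values are distinct, comparing them for increasing pairs of positions
    settles all the other comparisons. *)
Lemma contains3P n (a : 'S_3) (p : 'S_n) :
  reflect (exists x y z : 'I_n,
             [/\ x < y, y < z,
                 (p x < p y) = (a (inord 0) < a (inord 1)),
                 (p x < p z) = (a (inord 0) < a (inord 2)) &
                 (p y < p z) = (a (inord 1) < a (inord 2))])
          (contains a p).
Proof.
apply: (iffP existsP) => [[f /andP[/forallP inc /forallP ord_f]]|].
  have lt_f (i j : 'I_3) : i < j -> f i < f j.
    by move: (inc i) => /forallP/(_ j)/implyP.
  have eq_f (i j : 'I_3) : (p (f i) < p (f j)) = (a i < a j).
    by move: (ord_f i) => /forallP/(_ j)/eqP.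
  exists (f (inord 0)), (f (inord 1)), (f (inord 2)).
  by split; rewrite ?eq_f //; apply: lt_f; rewrite !inordK.
case=> x [y [z [xy yz pxy pxz pyz]]].
exists [ffun i : 'I_3 => nth x [:: x; y; z] i].
(* Reversed comparisons are negations, as distinct positions carry distinct
   values. *)
have asym m (q : 'S_m) (u v : 'I_m) : u < v -> (q v < q u) = ~~ (q u < q v).
  move=> lt_uv; rewrite -leqNgt [RHS]leq_eqVlt.
  by case: eqP => // /val_inj /perm_inj eq_vu; rewrite eq_vu ltnn in lt_uv.
have xz := ltn_trans xy yz.
apply/andP; split; apply/forallP; elim/ord3_ind; apply/forallP; elim/ord3_ind;
  rewrite !ffunE !inordK //= ?ltnn ?xy ?yz ?xz // ?pxy ?pxz ?pyz //;
  by rewrite ?(asym _ p _ _ xy) ?(asym _ p _ _ yz) ?(asym _ p _ _ xz)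
       ?pxy ?pxz ?pyz -asym ?inordK.
Qed.

Lemma contains132P n (p : 'S_n) :
  reflect (exists x y z : 'I_n, [/\ x < y, y < z, p x < p z & p z < p y])
          (contains p132 p).
Proof.
apply: (iffP (contains3P _ _)) => -[x [y [z]]];
  rewrite !permE /= -!val_eqE /= !inordK //= => -[xy yz h1 h2];
  [move=> h3|]; exists x, y, z; split=> //; try lia.
have: p y != p z by rewrite (inj_eq perm_inj) -val_eqE /=; lia.
by rewrite -val_eqE /=; lia.
Qed.

Lemma contains213P n (p : 'S_n) :
  reflect (exists x y z : 'I_n, [/\ x < y, y < z, p y < p x & p x < p z])
          (contains p213 p).
Proof.
apply: (iffP (contains3P _ _)) => -[x [y [z]]];
  rewrite !permE /= -!val_eqE /= !inordK //= => -[xy yz h1 h2];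
  [move=> h3|]; exists x, y, z; split=> //; try lia.
have: p x != p y by rewrite (inj_eq perm_inj) -val_eqE /=; lia.
by rewrite -val_eqE /=; lia.
Qed.

Lemma contains321P n (p : 'S_n) :
  reflect (exists x y z : 'I_n, [/\ x < y, y < z, p z < p y & p y < p x])
          (contains p321 p).
Proof.
apply: (iffP (contains3P _ _)) => -[x [y [z]]];
  rewrite !permE /= -!val_eqE /= !inordK //= => -[xy yz h1 h2];
  [move=> h3|]; exists x, y, z; split=> //; try lia.
- have: p y != p z by rewrite (inj_eq perm_inj) -val_eqE /=; lia.
  by rewrite -val_eqE /=; lia.
- have: p x != p y by rewrite (inj_eq perm_inj) -val_eqE /=; lia.
  by rewrite -val_eqE /=; lia.
Qed.

Definition T3 : seq pattern :=
  [:: mkpattern p132; mkpattern p213; mkpattern p321].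

Definition avoids_all n (T : seq pattern) (p : 'S_n) : bool :=
  all (fun a => avoids (projT2 a) p) T.

Definition shift m (d : 'I_m.+1) : 'S_m.+1 := perm (GRing.addrI d).

Lemma shiftE m (d i : 'I_m.+1) : shift d i = (d + i)%R.
Proof. by rewrite permE. Qed.

Lemma shift_inj m : injective (@shift m).
Proof.
by move=> d e /permP/(_ ord0); rewrite !shiftE => /GRing.addIr.
Qed.

Lemma val_shift m (d i : 'I_m.+1) :
  shift d i = (if d + i <= m then d + i else d + i - m.+1) :> nat.
Proof.
rewrite shiftE /=; case: leqP => [le_m|lt_m]; first by rewrite modn_small.
rewrite -[X in X %% _](subnK lt_m) modnDr modn_small //.
by have := ltn_ord d; have := ltn_ord i; lia.
Qed.

(** On each run, where [d + i] does or does not wrap around, the shift increases,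
    and the wrapped values are the smaller ones.  The order of three values is
    then decided by which of the three positions wrap. *)
Lemma shift_avoids m (d : 'I_m.+1) : avoids_all T3 (shift d).
Proof.
apply/and4P; split=> //;
  [apply/contains132P | apply/contains213P | apply/contains321P];
  case=> x [y [z []]]; rewrite !val_shift;
  have := ltn_ord d; have := ltn_ord x; have := ltn_ord y; have := ltn_ord z;
  by do 3 case: ifP => ?; lia.
Qed.

(** The core of the classification: a value breaking the rule would form one of
    the patterns together with the adjacent pair [p i], [p j].  That value is
    [p i + 1] at an ascent; at a descent it is the greatest value or the least
    one. *)
Lemma avoiding_cyclic_succ m (p : 'S_m.+1) (i j : 'I_m.+1) :
  avoids_all T3 p -> j = i.+1 :> nat ->
  p j = (if p i < m then (p i).+1 else 0) :> nat.
Proof.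
case/and4P=> /contains132P no132 /contains213P no213 /contains321P no321 _ ij.
have lt_ij : i < j by rewrite ij.
(* No position fits between [i] and [j], so any third value sits on the left or
   on the right of the adjacent pair. *)
have locate (v : 'I_m.+1) : v != p i -> v != p j ->
    exists2 k, p k = v & k < i \/ j < k.
  move=> vi vj; exists ((p^-1)%g v); rewrite ?permKV //.
  have : (p^-1)%g v != i by apply: contraNneq vi => <-; rewrite permKV.
  have : (p^-1)%g v != j by apply: contraNneq vj => <-; rewrite permKV.
  by rewrite -!val_eqE /= ij; lia.
have lt_pi := ltn_ord (p i); have lt_pj := ltn_ord (p j).
have : p i != p j by rewrite (inj_eq perm_inj) -val_eqE /= ij; lia.
rewrite -val_eqE /= neq_ltn => /orP[asc|desc].
  have -> : p i < m by lia.
  apply/eqP; apply: contraT => gap.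
  have lt_v : (p i).+1 < m.+1 by lia.
  have [||k pk [ki|jk]] := locate (Ordinal lt_v).
  - by rewrite -val_eqE /=; lia.
  - by rewrite -val_eqE /=; lia.
  - by case: no213; exists k, i, j; rewrite pk /=; split=> //; lia.
  - by case: no132; exists i, j, k; rewrite pk /=; split=> //; lia.
have -> : (p i < m) = false.
  apply: contraTF isT => lt_max.
  have [||k pk [ki|jk]] := locate ord_max.
  - by rewrite -val_eqE /=; lia.
  - by rewrite -val_eqE /=; lia.
  - by case: no321; exists k, i, j; rewrite pk /=; split=> //; lia.
  - by case: no213; exists i, j, k; rewrite pk /=; split=> //; lia.
apply/eqP; apply: contraT => pj_neq0.
have [||k pk [ki|jk]] := locate ord0.
- by rewrite -val_eqE /=; lia.
- by rewrite -val_eqE /=; lia.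
- by case: no132; exists k, i, j; rewrite pk /=; split=> //; lia.
- by case: no321; exists i, j, k; rewrite pk /=; split=> //; lia.
Qed.

Lemma avoiding_shift m (p : 'S_m.+1) : avoids_all T3 p -> p = shift (p ord0).
Proof.
move=> av; apply/permP=> -[i lt_i]; apply: val_inj; rewrite /= val_shift /=.
elim: i lt_i => [|i IHi] lt_i.
  have -> : Ordinal lt_i = ord0 by apply: val_inj.
  by have := ltn_ord (p ord0); rewrite addn0 ltnS => ->.
rewrite (@avoiding_cyclic_succ m p (Ordinal (ltnW lt_i))) // IHi.
have := ltn_ord (p ord0).
by do ! case: ifP; lia.
Qed.

Lemma card_fixpoints_shift m (d : 'I_m.+1) :
  #|fixpoints (shift d)| = if d == ord0 then m.+1 else 0.
Proof.
have fixE i : (i \in fixpoints (shift d)) = (d == ord0).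
  rewrite inE shiftE -{2}[i]GRing.add0r (inj_eq (@GRing.addIr _ _)).
  by rewrite -!val_eqE.
case: eqP fixE => _ fixE; last by apply: eq_card0.
by rewrite -[RHS]card_ord; apply: eq_card.
Qed.

(** Shifting is injective and its image is the set of avoiders, so the count can
    be done on the shift amounts, whose fixed points are known. *)
Lemma num_avoiders_shift m k :
  num_avoiders m.+1 k T3 =
  #|[set d : 'I_m.+1 | (if d == ord0 then m.+1 else 0) == k]|.
Proof.
rewrite -(card_imset _ (@shift_inj m)); apply: eq_card => p.
rewrite inE; apply/andP/imsetP => [[fix_p /avoiding_shift def_p]|[d]].
  by exists (p ord0) => //; rewrite inE -card_fixpoints_shift -def_p.
by rewrite inE -card_fixpoints_shift => fix_d ->; split=> //; apply: shift_avoids.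
Qed.

Theorem theorem3p6 (n : nat) (hn : 3 <= n) :
  let T := [:: mkpattern p132; mkpattern p213; mkpattern p321] in
  num_avoiders n 0 T = n - 1 /\
  (forall k : nat, 1 <= k <= n -> num_avoiders n k T = (n == k)).
Proof.
case: n hn => // m _ T; rewrite {}/T -/T3; split=> [|k /andP[k_gt0 _]].
  rewrite num_avoiders_shift.
  have -> : m.+1 - 1 = #|predC1 (@ord0 m)| by rewrite cardC1 card_ord subn1.
  by apply: eq_card => d; rewrite !inE; case: (d == ord0).
rewrite num_avoiders_shift; case: eqP => [<-|neq_mk].
  apply: etrans (cards1 (@ord0 m)).
  by apply: eq_card => d; rewrite !inE; case: (d == ord0); rewrite ?eqxx.
by apply: eq_card0 => d; rewrite inE; case: (d == ord0); apply/negbTE/eqP; lia.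
Qed.
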